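(* Let $d\in\mathbb{N}$, $d\ge1$. If $\mathbf{x}\in[-1,1]^d$ is Diophantine, then for any integer $n\ge 1$ $$e_n(\mathbf{x})\ \le\ \frac{n^{d+1}}{(d-1)!\,(d+1)}\log n+O(n^{d+1}),$$ where the implied constant depends on $\mathbf{x}$ and $d$ only; that is, there is a constant $C>0$ depending only on $\mathbf{x}$ and $d$ such that for all integers $n\ge 1$, $e_n(\mathbf{x})\le \frac{n^{d+1}}{(d-1)!\,(d+1)}\log n+C\,n^{d+1}$. In particular, this estimate (with a constant depending on $\mathbf{x}$ and $d$) holds for Lebesgue-almost every $\mathbf{x}\in[-1,1]^d$.
   Context: For $\ell\in\mathbb{N}$ let $\Delta^{\ell}=\{(z_1,\dots,z_\ell)\in\mathbb{C}^{\ell}: |z_i|\le 1 \text{ for all } i\}$ be the closed unit polydisk, and for $n\in\mathbb{N}$ let $\mathcal{P}_n(\ell)$ be the vector space of polynomials in $\mathbb{C}[z_1,\dots,z_\ell]$ of (total) degree at most $n$. For $D\subset\mathbb{C}^\ell$ and a polynomial $P$ put $\|P\|_D=\sup\{|P(\mathbf{z})|:\mathbf{z}\in D\}$. For $\mathbf{x}=(x_1,\dots,x_d)\in[-1,1]^d$ put $$K=K(\mathbf{x})=\{(e^{z},e^{x_1z},e^{x_2z},\dots,e^{x_dz}): z\in\mathbb{C},\ |z|\le 1\}\subset\mathbb{C}^{d+1},$$ $$E_n(\mathbf{x})=\sup\{\|P\|_{\Delta^{d+1}}: P\in\mathcal{P}_n(d+1),\ \|P\|_K\le 1\},\qquad e_n(\mathbf{x})=\log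 E_n(\mathbf{x}).$$ For $x\in\mathbb{R}$, $\langle x\rangle=\min\{|x-k|:k\in\mathbb{Z}\}$ is the distance to the nearest integer, and on $\mathbb{R}^d$, $\|\mathbf{q}\|=\max_{1\le i\le d}|q_i|$. A vector $\mathbf{x}\in\mathbb{R}^d$ is called Diophantine if there exist $\mu\ge d$ and $\epsilon>0$ such that $\langle\mathbf{q}\cdot\mathbf{x}\rangle>\epsilon\|\mathbf{q}\|^{-\mu}$ for all $\mathbf{q}\in\mathbb{Z}^d\setminus\{\mathbf{0}\}$. (In particular, for a Diophantine vector, $\{1,x_1,\dots,x_d\}$ is linearly independent over $\mathbb{Z}$.) *)

(* Defs.v *)
From HB Require Import structures.
From mathcomp Require Import all_boot all_order all_algebra.
From mathcomp Require Import all_classical all_reals all_analysis measurable_realfun.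
From mathcomp.real_closed Require Import complex.
From mathcomp Require mpoly.
Import (canonicals, coercions) mpoly.

Set Implicit Arguments.
Unset Strict Implicit.
Unset Printing Implicit Defensive.
Import Order.TTheory GRing.Theory Num.Theory.
Local Open Scope classical_set_scope.
Local Open Scope ring_scope.
Local Open Scope complex_scope.

Definition cexp (R : realType) (z : R[i]) : R[i] :=
  let: a +i* b := z in (expR a * cos b) +i* (expR a * sin b).

Definition polydisk (R : realType) (l : nat) : set (l.-tuple R[i]) :=
  [set z | forall i, `|tnth z i| <= 1].

(* msize is one more than the total degree, and 0 for the zero polynomial. *)
Definition poly_deg_le (R : realType) (l n : nat) : set (mpoly.mpoly l R[i]) :=
  [set P | (mpoly.msize P <= n.+1)%N].

Definition supnorm (R : realType) (l : nat) (D : set (l.-tuple R[i]))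
    (P : mpoly.mpoly l R[i]) : \bar R :=
  ereal_sup [set (ComplexField.Normc.normc (mpoly.meval (tnth z) P))%:E | z in D].

Definition exp_curve (R : realType) (d : nat) (x : d.-tuple R) :
    set (d.+1.-tuple R[i]) :=
  [set [tuple of cexp z :: [tuple cexp ((tnth x j)%:C * z) | j < d]]
    | z in [set z : R[i] | `|z| <= 1]].

Definition bernstein_const (R : realType) (d : nat) (x : d.-tuple R) (n : nat) :
    \bar R :=
  ereal_sup [set supnorm (@polydisk R d.+1) P
    | P in [set P | poly_deg_le n P /\ (supnorm (exp_curve x) P <= 1)%E]].

Definition bernstein_exponent (R : realType) (d : nat) (x : d.-tuple R)
    (n : nat) : \bar R :=
  lne (bernstein_const x n).

Definition dist_int (R : realType) (x : R) : R :=
  inf [set `|x - k%:~R| | k in [set: int]].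

Definition dot_int (R : realType) (d : nat) (q : 'rV[int]_d) (x : d.-tuple R) : R :=
  \sum_(i < d) (q 0 i)%:~R * tnth x i.

Definition max_norm (R : realType) (d : nat) (q : 'rV[int]_d) : R :=
  \big[Num.max/0]_(i < d) `|(q 0 i)%:~R|.

Definition diophantine (R : realType) (d : nat) (x : d.-tuple R) : Prop :=
  exists mu eps : R, [/\ d%:R <= mu, 0 < eps &
    forall q : 'rV[int]_d, q != 0 ->
      eps * max_norm R q `^ (- mu) < dist_int (dot_int q x)].

Definition cube (R : realType) (d : nat) : set (d.-tuple R) :=
  [set x | forall i, -1 <= tnth x i <= 1].

(* Lebesgue measure on R^d, as the iterated product of the one-dimensional
   Lebesgue measure; see lebesgue_tuple_box. *)
Fixpoint lebesgue_tuple (R : realType) (d : nat) :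
    set (d.-tuple (measurableTypeR R)) -> \bar R :=
  match d with
  | 0 => fun A => \d_([tuple] : 0.-tuple (measurableTypeR R)) A
  | d'.+1 => fun A => (\int[@lebesgue_measure R]_t
      lebesgue_tuple [set v : d'.-tuple (measurableTypeR R) | A [tuple of t :: v]])%E
  end.

Section lebesgue_tuple_measure.
Context (R : realType).

Let consf (d : nat) (p : measurableTypeR R * d.-tuple (measurableTypeR R)) :
    d.+1.-tuple (measurableTypeR R) :=
  [tuple of p.1 :: p.2].

Let mconsf d : measurable_fun setT (@consf d).
Proof.
by apply: measurable_cons; [exact: measurable_fst|exact: measurable_snd].
Qed.

Let mbehead d : measurable_fun setT
  (fun x : d.+1.-tuple (measurableTypeR R) => (thead x, [tuple of behead x])).
Proof.
by apply: measurable_fun_pair; [exact: measurable_tnth|exact: measurable_behead].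
Qed.

Section step.
Context (d : nat)
  (m : {sigma_finite_measure set (d.-tuple (measurableTypeR R)) -> \bar R}).

Let push := pushforward (@lebesgue_measure R \x m)%E (@consf d).

Let mf := @mconsf d.

Let push0 : push set0 = 0%E. Proof. exact: measure0. Qed.

Let push_ge0 A : (0 <= push A)%E. Proof. exact: measure_ge0. Qed.

Let push_sigma_additive : semi_sigma_additive push.
Proof. exact: measure_semi_sigma_additive. Qed.

HB.instance Definition _ := isMeasure.Build _ _ _ push
  push0 push_ge0 push_sigma_additive.

Let push_sigma_finite : sigma_finite setT push.
Proof.
have /sigma_finiteP[F [FT ndF Foo]] := sigma_finiteT (@lebesgue_measure R).
have /sigma_finiteP[G [GT ndG Goo]] := sigma_finiteT m.
pose f (x : d.+1.-tuple (measurableTypeR R)) := (thead x, [tuple of behead x]).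
exists (fun k => f @^-1` (F k `*` G k)).
  apply/esym; rewrite -subTset => x _.
  have [i _ Fi] : (\bigcup_i F i) (thead x) by rewrite -FT.
  have [j _ Gj] : (\bigcup_i G i) [tuple of behead x] by rewrite -GT.
  exists (maxn i j) => //; split.
    by move: Fi; exact/subsetPset/ndF/leq_maxl.
  by move: Gj; exact/subsetPset/ndG/leq_maxr.
move=> k; have [mF Fk] := Foo k; have [mG Gk] := Goo k; split.
  by rewrite -[X in measurable X]setTI; apply: mbehead => //; exact: measurableX.
have fK p : f (consf p) = p.
  by case: p => t v; congr pair; exact: val_inj.
rewrite /push /pushforward (_ : _ @^-1` _ = F k `*` G k).
  by rewrite product_measure1E// lte_mul_pinfty// ge0_fin_numE.
by apply/seteqP; split => p; rewrite /preimage /mkset fK.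
Qed.

HB.instance Definition _ :=
  Measure_isSigmaFinite.Build _ _ _ push push_sigma_finite.

Lemma lebesgue_tuple_step :
  exists m' : {sigma_finite_measure set (d.+1.-tuple (measurableTypeR R)) -> \bar R},
    forall A, m' A = (\int[@lebesgue_measure R]_t
      m [set v : d.-tuple (measurableTypeR R) | A [tuple of t :: v]])%E.
Proof.
exists push => A; rewrite /= /push /pushforward /product_measure1.
apply: eq_integral => t _ /=; congr (m _); rewrite xsectionE.
by apply/seteqP; split.
Qed.

End step.

Lemma lebesgue_tuple_ex d :
  exists m : {sigma_finite_measure set (d.-tuple (measurableTypeR R)) -> \bar R},
    forall A, lebesgue_tuple A = m A.
Proof.
elim: d => [|d [m mE]].
  by exists (\d_([tuple] : 0.-tuple (measurableTypeR R))).
have [m' m'E] := lebesgue_tuple_step m.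
exists m' => A; rewrite m'E; apply: eq_integral => t _; exact: mE.
Qed.

Context (d : nat).
Let mu : set (d.-tuple (measurableTypeR R)) -> \bar R := @lebesgue_tuple R d.

Let mu0 : mu set0 = 0%E.
Proof. by have [m E] := lebesgue_tuple_ex d; rewrite /mu E measure0. Qed.

Let mu_ge0 A : (0 <= mu A)%E.
Proof. by have [m E] := lebesgue_tuple_ex d; rewrite /mu E measure_ge0. Qed.

Let mu_sigma : semi_sigma_additive mu.
Proof.
have [m E] := lebesgue_tuple_ex d.
by rewrite (_ : mu = m); [exact: measure_semi_sigma_additive|exact/funext].
Qed.

HB.instance Definition _ :=
  isMeasure.Build _ _ _ (@lebesgue_tuple R d) mu0 mu_ge0 mu_sigma.

Let mu_sigma_finite : sigma_finite setT mu.
Proof.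
have [m E] := lebesgue_tuple_ex d.
by rewrite (_ : mu = m); [exact: sigma_finiteT|exact/funext].
Qed.

HB.instance Definition _ :=
  Measure_isSigmaFinite.Build _ _ _ (@lebesgue_tuple R d) mu_sigma_finite.

End lebesgue_tuple_measure.

Lemma lebesgue_tuple_box (R : realType) (d : nat)
    (A : 'I_d -> set (measurableTypeR R)) :
  (forall i, measurable (A i)) ->
  lebesgue_tuple [set x | forall i, A i (tnth x i)] =
    (\prod_(i < d) lebesgue_measure (A i))%E.
Proof.
elim: d A => [|d IH] A mA.
  rewrite big_ord0 /= diracE mem_set//= => -[].
  by [].
rewrite big_ord_recl /=.
have -> : (fun t => lebesgue_tuple [set v : d.-tuple (measurableTypeR R) |
      forall i, A i (tnth [tuple of t :: v] i)]) =
   (fun t => (\prod_(i < d) lebesgue_measure (A (lift ord0 i))) *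
             (\1_(A ord0) t)%:E)%E.
  apply/funext => t; rewrite indicE; have [tA|tA] := boolP (t \in A ord0).
    rewrite mule1 -IH//; congr lebesgue_tuple.
    apply/seteqP; split => [v /= H i|v /= H i].
      by have := H (lift ord0 i); rewrite tnthS.
    have [j ->|->] := unliftP ord0 i; first by rewrite tnthS; exact: H.
    by rewrite tnth0; exact: set_mem.
  rewrite mule0 [X in lebesgue_tuple X](_ : _ = set0) ?measure0//.
  by apply/seteqP; split => // v /= /(_ ord0); rewrite tnth0 => /mem_set;
    rewrite (negbTE tA).
rewrite ge0_integralZl//.
- rewrite (@integral_indic _ _ _ (@lebesgue_measure R))//.
  by rewrite setIT muleC.
- apply: measurableT_comp => //; exact: measurable_indic.
- by apply: prode_ge0 => i _; exact: measure_ge0.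
Qed.

(* Main.v *)
Require Import Defs.
From HB Require Import structures.
From mathcomp Require Import all_boot all_order all_algebra.
From mathcomp Require Import all_classical all_reals all_analysis.
From mathcomp Require Import measurable_realfun.
From mathcomp Require Import ring lra zify.
From mathcomp.real_closed Require Import complex.
From mathcomp Require mpoly.
Import (canonicals, coercions) mpoly.

Set Implicit Arguments.
Unset Strict Implicit.
Unset Printing Implicit Defensive.
Import Order.TTheory GRing.Theory Num.Theory.
Local Open Scope classical_set_scope.
Local Open Scope ring_scope.

(** At a real parameter t the restriction to the curve of a polynomial P of
    degree at most n is an exponential sum: the sum over the N monomials b of
    c_b exp(l_b t), where the frequency of z_0^j z_1^(k_1) ... z_d^(k_d) is
    l_b = j + k.x.  Since |P| is at most the sum of the |c_b| on the polydisk,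
    it is enough to bound each coefficient.

    Upper bound for a coefficient.  Put u_b = exp(l_b / M) with M >= N.  The
    values of the sum at t = 0, 1/M, ..., (N-1)/M are the power sums
    sum_b c_b u_b^i, so the polynomial with roots u_b for b <> a, applied to
    these values, isolates c_a (lagrange_coef_bound).  Because the values are at
    most 1 and the distances |u_a - u_b| are comparable with |l_a - l_b| / M,
    |c_a| is at most (A M)^N / prod_(b <> a) |l_a - l_b| for an absolute
    constant A (exp_sum_coef_bound).  Here M has order n^(d+1), which makes the
    numerator exp(N (d+1) log n + O(n^(d+1))).  Sampling at real points
    takes the place of Cauchy estimates for the derivatives at 0: it costs a
    factor exp(O(N)), which the error term absorbs.

    Lower bound for the product.  For each fixed k the frequencies form an
    arithmetic progression of step 1 with m + 1 terms, m = n - |k|.  If l_a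
    stays at distance delta from it, then the product of the distances is at
    least delta m! / 2^m (progression_prod_ge), and m! >= n^m exp(-n).
    A Diophantine vector allows delta = eps n^(-mu), and there are at most
    (n+1)^d progressions, so the factors delta cost only exp(O(n^d log n)) and
    the whole product is at least n^N exp(- O(n^(d+1))) (gap_product_ge).

    Together, log |c_a| <= N d log n + O(n^(d+1)).  As
    N = binomial(n+d+1, d+1) = n^(d+1) / (d+1)! + O(n^d) (bin_asymp), and
    d / (d+1)! = 1 / ((d-1)! (d+1)), this is the claimed estimate.

    Almost every vector of the cube is Diophantine with exponent d + 3.  For a
    nonzero integer vector q and an integer p, the points of the cube where
    |q.x - p| <= e form a slab of measure at most 2^d e.  There are O(m^(d+1)) pairs
    (q, p) such that q has max-norm m and the slab meets the cube, so the slabs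
    with e = 2 eps m^(-(d+3)) have total measure
    O(eps sum_m m^(-2)) = O(eps), and eps is arbitrary. *)

(** * Coefficients of exponential sums *)

(** Multiplying a polynomial by X - b increases the sum of the absolute values
    of the coefficients by a factor at most 1 + |b|; summing up to any n avoids
    any reference to the degree. *)
Lemma sum_normr_coef_prod_XsubC (C : numDomainType) (s : seq C) (n : nat) :
  \sum_(k < n) `|(\prod_(b <- s) ('X - b%:P))`_k| <= \prod_(b <- s) (1 + `|b|).
Proof.
elim: s n => [|b s IHs] n.
  rewrite !big_nil; case: n => [|n]; first by rewrite big_ord0.
  rewrite big_ord_recl coef1 normr1 big1 ?addr0// => i _.
  by rewrite coef1 normr0.
rewrite !big_cons; set p := \prod_(j <- s) ('X - j%:P) in IHs *.
have shift_le : \sum_(k < n) `|('X * p)`_k| <= \prod_(j <- s) (1 + `|j|).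
  case: n => [|n].
    by rewrite big_ord0; apply: prodr_ge0 => j _; rewrite addr_ge0.
  rewrite big_ord_recl coefXM eqxx normr0 add0r.
  rewrite (eq_bigr (fun k : 'I_n => `|p`_k|)) => [|k _]; first exact: IHs.
  by rewrite coefXM.
have tri_le : \sum_(k < n) `|(('X - b%:P) * p)`_k| <=
    \sum_(k < n) (`|('X * p)`_k| + `|b| * `|p`_k|).
  by apply: ler_sum => k _; rewrite mulrBl coefB coefCM -normrM ler_normB.
apply: (le_trans tri_le).
rewrite big_split /= -mulr_sumr mulrDl mul1r; apply: lerD shift_le _.
by apply: ler_wpM2l; [exact: normr_ge0|exact: IHs].
Qed.

(** The hypothesis bounds the first #|I| power sums of the nodes u weighted by
    c.  Combining them with the coefficients of the polynomial Q that vanishes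
    at all nodes but u a leaves the single term c a * Q(u a). *)
Lemma lagrange_coef_bound (C : numDomainType) (I : finType) (u c : I -> C)
    (a : I) :
  (forall k, (k < #|I|)%N -> `|\sum_i c i * u i ^+ k| <= 1) ->
  `|c a| * \prod_(b | b != a) `|u a - u b| <= \prod_(b | b != a) (1 + `|u b|).
Proof.
move=> c_le1.
pose s := [seq u b | b <- enum (predC1 a)].
pose Q := \prod_(b <- s) ('X - b%:P).
have sQ : size Q = #|I|.
  rewrite size_prod_XsubC size_map -cardE (cardC1 a) prednK//.
  by apply/card_gt0P; exists a.
have QE x : Q.[x] = \prod_(b | b != a) (x - u b).
  rewrite horner_prod big_map big_enum_cond /=.
  by apply: eq_big => [b|b _]; rewrite ?andbT ?hornerE.
have Qu b : b != a -> Q.[u b] = 0.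
  by move=> ba; rewrite QE (bigD1 b)//= subrr mul0r.
have E : \sum_(k < #|I|) Q`_k * (\sum_i c i * u i ^+ k) = c a * Q.[u a].
  under eq_bigr do rewrite mulr_sumr.
  rewrite exchange_big /= (bigD1 a)//= [X in _ + X]big1 ?addr0; last first.
    move=> i ia; transitivity (c i * Q.[u i]); last by rewrite Qu// mulr0.
    by rewrite horner_coef mulr_sumr sQ; apply: eq_bigr => k _; rewrite mulrCA.
  by rewrite horner_coef mulr_sumr sQ; apply: eq_bigr => k _; rewrite mulrCA.
have -> : \prod_(b | b != a) `|u a - u b| = `|Q.[u a]| by rewrite QE normr_prod.
rewrite -normrM -E; apply: (le_trans (ler_norm_sum _ _ _)).
have -> : \prod_(b | b != a) (1 + `|u b|) = \prod_(b <- s) (1 + `|b|).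
  by rewrite big_map big_enum_cond; apply: eq_bigl => b; rewrite andbT.
apply: le_trans (sum_normr_coef_prod_XsubC s #|I|).
apply: ler_sum => k _; rewrite normrM -[leRHS]mulr1 ler_wpM2l//.
exact: c_le1.
Qed.

Local Open Scope complex_scope.

Lemma ler_dist_expR (R : realType) (a b : R) :
  -1 <= a -> -1 <= b -> `|a - b| <= expR 1 * `|expR a - expR b|.
Proof.
wlog ab : a b / b <= a => [hw a1 b1|_ b1].
  have [ab|/ltW ab] := leP b a; first exact: hw.
  by rewrite distrC [`|expR a - _|]distrC; exact: hw.
rewrite !ger0_norm ?subr_ge0 ?ler_expR//.
have -> : expR a = expR b * expR (a - b) by rewrite -expRD addrC subrK.
rewrite -[X in _ * X]/(_ * _ - _) -{2}[expR b]mulr1 -mulrBr mulrA -expRD.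
have := expR_ge1Dx (a - b); rewrite -lerBrDl => /le_trans; apply.
apply: ler_peMl; first by rewrite subr_ge0 -[leLHS]expR0 ler_expR subr_ge0.
by rewrite -[leLHS]expR0 ler_expR -lerBlDl sub0r.
Qed.

(** The nodes are exp(l b / M).  The condition #|I| <= M keeps the sample points
    k / M in the unit interval, and |l b| <= M keeps the exponents l b / M in
    [-1, 1], where exp and its inverse are Lipschitz. *)
Lemma exp_sum_coef_bound (R : realType) (I : finType) (l : I -> R)
    (c : I -> R[i]) (M : R) (a : I) :
  #|I|%:R <= M -> (forall i, `|l i| <= M) ->
  (forall t, 0 <= t <= 1 -> `|\sum_i c i * (expR (l i * t))%:C| <= 1) ->
  `|c a| * (\prod_(b | b != a) `|l a - l b|)%:C
    <= (((1 + expR 1) * expR 1 * M) ^+ #|I|)%:C.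
Proof.
move=> IM lM c_le1.
have I0 : (0 < #|I|)%N by apply/card_gt0P; exists a.
have M1 : 1 <= M by apply: le_trans IM; rewrite ler1n.
have M0 : 0 < M by apply: lt_le_trans M1.
have E1 : 1 <= expR 1 :> R by rewrite -[leLHS]expR0 ler_expR.
have lt1 b : -1 <= l b / M <= 1.
  by rewrite -ler_norml normrM normfV (gtr0_norm M0) ler_pdivrMr ?mul1r.
have nC (x : R) : `|x%:C| = `|x|%:C :> R[i].
  by rewrite normc_def /= expr0n addr0 sqrtr_sqr.
pose u i := (expR (l i / M))%:C.
have := @lagrange_coef_bound _ _ u c a.
have -> : \prod_(b | b != a) `|u a - u b| =
    (\prod_(b | b != a) `|expR (l a / M) - expR (l b / M)|)%:C.
  by rewrite rmorph_prod; apply: eq_bigr => b _; rewrite -rmorphB nC.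
have -> : \prod_(b | b != a) (1 + `|u b|) =
    (\prod_(b | b != a) (1 + expR (l b / M)))%:C.
  rewrite rmorph_prod; apply: eq_bigr => b _.
  by rewrite nC rmorphD rmorph1 ger0_norm ?expR_ge0.
have c_le k : (k < #|I|)%N -> `|\sum_i c i * u i ^+ k| <= 1.
  move=> kI; under eq_bigr do rewrite /u -rmorphXn -expRM_natr.
  under eq_bigr do rewrite -mulrA [_ * k%:R]mulrC.
  apply: c_le1; rewrite divr_ge0 ?(ltW M0)//= ler_pdivrMr// mul1r.
  by rewrite (le_trans _ IM)// ler_nat ltnW.
move=> /(_ c_le) H.
have [r cr] : exists r : R, `|c a| = r%:C by rewrite normc_def; eexists.
have r0 : 0 <= r by rewrite -lecR -cr normr_ge0.
move: H; rewrite cr -!rmorphM !lecR /= => H.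
have step1 : \prod_(b | b != a) `|l a - l b| <=
   (expR 1 * M) ^+ #|I|.-1 *
     \prod_(b | b != a) `|expR (l a / M) - expR (l b / M)|.
  rewrite -(cardC1 a) -prodr_const -big_split /=; apply: ler_prod => b _.
  rewrite normr_ge0 /= mulrAC -ler_pdivrMr//.
  have /andP[a1 _] := lt1 a; have /andP[b1 _] := lt1 b.
  by have := ler_dist_expR a1 b1; rewrite -mulrBl normrM normfV (gtr0_norm M0).
have step2 : \prod_(b | b != a) (1 + expR (l b / M)) <= (1 + expR 1) ^+ #|I|.-1.
  rewrite -(cardC1 a) -prodr_const; apply: ler_prod => b _.
  by rewrite addr_ge0 ?expR_ge0//= lerD2l ler_expR; have /andP[] := lt1 b.
apply: (@le_trans _ _ (((1 + expR 1) * (expR 1 * M)) ^+ #|I|.-1)).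
  rewrite exprMn mulrC; apply: le_trans (ler_wpM2r r0 step1) _.
  rewrite -mulrA [X in _ <= X]mulrC; apply: ler_wpM2l.
    by rewrite exprn_ge0// mulr_ge0 ?expR_ge0// ltW.
  by rewrite mulrC (le_trans H).
rewrite mulrA ler_weXn2l ?leq_pred//.
have : 1 <= expR 1 * M :> R by rewrite mulr_ege1.
by rewrite -mulrA => ?; rewrite mulr_ege1// lerDl expR_ge0.
Qed.

(** * Counting and factorising over monomials *)

(** The statement is multiplied by n because the error term n^(D-1) is not a
    natural power of n for D = 0, where the induction starts. *)
Lemma bin_asymp (R : realFieldType) (D : nat) :
  exists2 C : R, 0 <= C & forall n, (1 <= n)%N ->
    n%:R * 'C(D + n, D)%:R <= n%:R ^+ D.+1 / D`!%:R + C * n%:R ^+ D :> R.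
Proof.
elim: D => [|D [C C0 IH]].
  by exists 0 => // n _; rewrite bin0 mulr1 divr1 expr1 mul0r addr0.
exists (C + D.+1%:R / D`!%:R + C * D.+1%:R) => [|n n1].
  by rewrite !addr_ge0 // ?mulr_ge0 ?divr_ge0 ?ler0n.
have n1' : 1 <= n%:R :> R by rewrite ler1n.
have binE : D.+1%:R * 'C(D.+1 + n, D.+1)%:R = (D.+1 + n)%:R * 'C(D + n, D)%:R :> R.
  by rewrite -!natrM addSn mul_bin_diag.
have D1 : 1 <= D.+1%:R :> R by rewrite ler1n.
rewrite -(@ler_pM2l _ D.+1%:R)// mulrCA binE mulrCA.
apply: le_trans (ler_wpM2l (ler0n _ _) (IH n n1)) _.
set a := n%:R in n1' *; set e := D.+1%:R in D1 *; set f := D`!%:R^-1.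
rewrite factS natrM -/e invfM -/f natrD -/e -/a.
have f0 : 0 <= f by rewrite invr_ge0.
have e0 : e != 0 by rewrite gt_eqF//; lra.
set p := a ^+ D; have p0 : 0 <= p by rewrite exprn_ge0//; lra.
rewrite !exprS -/p.
have -> : e * (a * (a * p) * (e^-1 * f) + (C + e * f + C * e) * (a * p)) =
  a * (a * p) * f + e * (C + e * f + C * e) * (a * p) by field.
have pa : p <= a * p by rewrite ler_peMl.
have h1 : (e + a) * (a * p * f + C * p) =
  a * (a * p) * f + (e * f + C) * (a * p) + C * e * p by ring.
rewrite h1 -addrA lerD2l.
have h2 : C * e * p <= C * e * (a * p) by rewrite ler_wpM2l// mulr_ge0//; lra.
apply: (@le_trans _ _ ((C + e * f + C * e) * (a * p))); first by move: h2; lra.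
have K0 : 0 <= C + e * f + C * e by rewrite !addr_ge0// mulr_ge0//; lra.
by rewrite -mulrA; apply: ler_peMl => //; rewrite !mulr_ge0//; lra.
Qed.

Lemma bmultinom_ltn (l n : nat) (b : mpoly.bmultinom l n.+1) (i : 'I_l) :
  (b i < n.+1)%N.
Proof.
by apply: leq_ltn_trans (mpoly.bmdeg b); rewrite mpoly.mdegE (bigD1 i)//= leq_addr.
Qed.

Lemma card_bmultinom_le (l n : nat) :
  (#|{: mpoly.bmultinom l n.+1}| <= 'C(l + n, l))%N.
Proof.
rewrite -card_partial_ord_partitions.
pose t (b : mpoly.bmultinom l n.+1) : l.-tuple 'I_n.+1 := [tuple inord (b i) | i < l].
have t_inj : injective t.
  move=> b b' /(congr1 (fun s => tnth s)) E; apply/val_inj/mpoly.mnmP => i.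
  have := congr1 (fun s => val (s i)) E.
  by rewrite !tnth_mktuple /= !inordK ?bmultinom_ltn.
rewrite -(card_imset _ t_inj); apply/subset_leq_card/fintype.subsetP => s.
case/imsetP => b _ ->; rewrite inE big_tuple.
under eq_bigr do rewrite tnth_mktuple inordK ?bmultinom_ltn//.
by rewrite -ltnS -mpoly.mdegE mpoly.bmdeg.
Qed.

Definition mnm_tail (d n : nat) (b : mpoly.bmultinom d.+1 n.+1) :
    {ffun 'I_d -> 'I_n.+1} :=
  [ffun i => inord (b (lift ord0 i))].

(** For a fixed tail k the exponent of the first variable runs through an
    interval starting at 0: this groups the frequencies into arithmetic
    progressions. *)
Lemma prod_bmultinom (R : comPzSemiRingType) (d n : nat)
    (F : {ffun 'I_d -> 'I_n.+1} -> nat -> R) :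
  \prod_(b : mpoly.bmultinom d.+1 n.+1) F (mnm_tail b) (b ord0) =
  \prod_(k : {ffun 'I_d -> 'I_n.+1} | (\sum_i k i <= n)%N)
    \prod_(j < (n - \sum_i k i).+1) F k j.
Proof.
pose mk (p : {ffun 'I_d -> 'I_n.+1} * 'I_n.+1) : mpoly.bmultinom d.+1 n.+1 :=
  insubd mpoly.bm0
    (mpoly.Multinom [tuple of (p.2 : nat) :: [tuple (p.1 i : nat) | i < d]]).
have mdeg_mk k j : mpoly.mdeg
    (mpoly.Multinom [tuple of j :: [tuple (k i : nat) | i < d]]) = (j + \sum_i k i)%N
    :> nat.
  rewrite mpoly.mdegE big_ord_recl mpoly.multinomE tnth0; congr addn.
  by apply: eq_bigr => i _; rewrite mpoly.multinomE tnthS tnth_mktuple.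
have mkE (p : {ffun 'I_d -> 'I_n.+1} * 'I_n.+1) :
  (p.2 + \sum_i p.1 i <= n)%N -> mk p =
    mpoly.Multinom [tuple of (p.2 : nat) :: [tuple (p.1 i : nat) | i < d]]
    :> mpoly.multinom _.
  by move=> pn; rewrite /mk val_insubd mdeg_mk ltnS pn.
have mk0 (p : {ffun 'I_d -> 'I_n.+1} * 'I_n.+1) :
    (p.2 + \sum_i p.1 i <= n)%N -> mk p ord0 = p.2 :> nat.
  by move=> pn; rewrite mkE// mpoly.multinomE tnth0.
have mkS (p : {ffun 'I_d -> 'I_n.+1} * 'I_n.+1) i :
    (p.2 + \sum_i p.1 i <= n)%N -> mk p (lift ord0 i) = p.1 i :> nat.
  by move=> pn; rewrite mkE// mpoly.multinomE tnthS tnth_mktuple.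
pose unmk (b : mpoly.bmultinom d.+1 n.+1) : {ffun 'I_d -> 'I_n.+1} * 'I_n.+1 :=
  (mnm_tail b, inord (b ord0)).
have unmk_deg b : ((unmk b).2 + \sum_i (unmk b).1 i <= n)%N.
  rewrite -ltnS; apply: leq_ltn_trans (mpoly.bmdeg b).
  rewrite mpoly.mdegE big_ord_recl /= inordK ?bmultinom_ltn// leq_add2l.
  by apply: leq_sum => i _; rewrite ffunE inordK ?bmultinom_ltn.
rewrite (reindex_onto mk unmk) => [|b _]; last first.
  apply/val_inj/mpoly.mnmP => i.
  have [j ->|->] := unliftP ord0 i.
    by rewrite [LHS](mkS _ _ (unmk_deg b)) ffunE inordK ?bmultinom_ltn.
  by rewrite [LHS](mk0 _ (unmk_deg b)) inordK ?bmultinom_ltn.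
have tail_mk (p : {ffun 'I_d -> 'I_n.+1} * 'I_n.+1) :
    (p.2 + \sum_i p.1 i <= n)%N -> mnm_tail (mk p) = p.1.
  move=> pn; apply/ffunP => i; rewrite ffunE; apply: val_inj.
  by rewrite /= mkS// inordK.
have unmkK (p : {ffun 'I_d -> 'I_n.+1} * 'I_n.+1) :
    (p.2 + \sum_i p.1 i <= n)%N -> unmk (mk p) = p.
  move=> pn; rewrite /unmk tail_mk// mk0//; case: p {pn} => k j /=.
  by congr pair; apply: val_inj; rewrite /= inordK.
transitivity (\prod_(k : {ffun 'I_d -> 'I_n.+1} | (\sum_i k i <= n)%N)
    \prod_(j < n.+1 | (j < (n - \sum_i k i).+1)%N) F k j); last first.
  apply: eq_bigr => k _.
  by rewrite [RHS](big_ord_widen n.+1 (fun j => F k j))// ltnS leq_subr.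
rewrite pair_big_dep /=; apply: eq_big => [[k j]|[k j]] /=.
  have -> : (\sum_i k i <= n)%N && (j < (n - \sum_i k i).+1)%N =
      (j + \sum_i k i <= n)%N.
    rewrite ltnS; have [kn|kn] := leqP (\sum_i k i) n.
      by rewrite leq_subRL// addnC.
    by apply/esym/negbTE; rewrite -ltnNge (leq_trans kn)// leq_addl.
  apply/eqP/idP => [E|/(unmkK (k, j))//].
  by have := unmk_deg (mk (k, j)); rewrite E.
move=> /eqP E; have kj : (j + \sum_i k i <= n)%N.
  by have := unmk_deg (mk (k, j)); rewrite E.
by rewrite (tail_mk (k, j))// (mk0 (k, j)).
Qed.

(** * Separation of the frequencies *)
Definition freq (R : realType) (d : nat) (x : d.-tuple R)
    (k : 'I_d -> nat) (j : nat) : R :=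
  j%:R + \sum_i (k i)%:R * tnth x i.

(** A quantitative form, at level n, of the independence of 1 and the
    coordinates of x over the integers. *)
Definition separated (R : realType) (d n : nat) (x : d.-tuple R) (delta : R) :=
  forall (q : 'rV[int]_d) (j : int), q != 0 -> (forall i, `|q 0 i| <= n%:Z) ->
    delta <= `|dot_int q x - j%:~R|.

Lemma dist_int_le (R : realType) (y : R) (j : int) : dist_int y <= `|y - j%:~R|.
Proof.
by apply: ge_inf; [exists 0 => _ [k _ <-]; exact: normr_ge0|exists j].
Qed.

Lemma max_norm_le (R : realType) (d : nat) (q : 'rV[int]_d) (B : R) :
  0 <= B -> (forall i, `|(q 0 i)%:~R| <= B) -> max_norm R q <= B.
Proof. by move=> B0 qB; apply: bigmax_le. Qed.

Lemma max_norm_ge1 (R : realType) (d : nat) (q : 'rV[int]_d) :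
  q != 0 -> 1 <= max_norm R q.
Proof.
move=> q0; have /existsP[i qi] : [exists i, q 0 i != 0].
  apply: contra_neqT q0 => /existsPn qi.
  by apply/rowP => i; rewrite mxE; apply/eqP; have := qi i; rewrite negbK.
apply: le_trans (le_bigmax _ _ i).
by rewrite -intr_norm ler1z -gtz0_ge1 normr_gt0.
Qed.

Lemma diophantine_separated (R : realType) (d : nat) (x : d.-tuple R) :
  diophantine x ->
  exists mu eps : R, [/\ 0 <= mu, 0 < eps <= 1 &
    forall n : nat, (1 <= n)%N -> separated n x (eps * n%:R `^ (- mu))].
Proof.
case=> mu [eps [dmu eps0 H]]; exists mu, (Num.min eps 1).
have mu0 : 0 <= mu by apply: le_trans dmu.
split=> //; first by rewrite lt_min eps0 ltr01 ge_min lexx orbT.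
move=> n n1 q j q0 qn.
apply: le_trans (dist_int_le _ j); apply: le_trans (ltW (H q q0)).
apply: ler_pM; rewrite ?powR_ge0 ?le_min ?(ltW eps0) ?ler01 ?ge_min ?lexx//.
have q1 := max_norm_ge1 R q0.
rewrite !powRN lef_pV2 ?posrE ?powR_gt0 ?ltr0n//; last exact: lt_le_trans q1.
apply: ge0_ler_powR => //; rewrite ?nnegrE//.
  exact: le_trans q1.
apply: max_norm_le => // i.
by rewrite -intr_norm -[n%:R]/(n%:~R) ler_int.
Qed.

Lemma freq_gap (R : realType) (d n : nat) (x : d.-tuple R) (delta : R)
    (k l : {ffun 'I_d -> 'I_n.+1}) (i j : nat) (m : int) :
  separated n x delta -> k != l ->
  delta <= `|freq x (fun i => k i) i - freq x (fun i => l i) j - m%:~R|.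
Proof.
move=> sep kl.
pose q : 'rV[int]_d := \row_i ((k i)%:Z - (l i)%:Z).
have q0 : q != 0.
  apply: contra kl => /eqP/rowP q0; apply/eqP/ffunP => s; apply: val_inj.
  by have := q0 s; rewrite !mxE => /eqP; rewrite subr_eq0 => /eqP[].
have qn s : `|q 0 s| <= n%:Z.
  by rewrite mxE; have := ltn_ord (k s); have := ltn_ord (l s); lia.
have := sep q (j%:Z - i%:Z + m) q0 qn.
congr (_ <= `|_|); rewrite /freq /dot_int !rmorphD rmorphN /= -!pmulrn.
have -> : \sum_(s < d) (q 0 s)%:~R * tnth x s =
    \sum_s (k s)%:R * tnth x s - \sum_s (l s)%:R * tnth x s.
  by rewrite -sumrB; apply: eq_bigr => s _; rewrite mxE rmorphB /= mulrBl -!pmulrn.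
ring.
Qed.

Lemma freq_inj (R : realType) (d n : nat) (x : d.-tuple R) (delta : R)
    (k l : {ffun 'I_d -> 'I_n.+1}) (i j : nat) :
  0 < delta -> separated n x delta ->
  freq x (fun i => k i) i = freq x (fun i => l i) j -> k = l /\ i = j.
Proof.
move=> delta0 sep.
have [<- /addIr/eqP|kl E] := eqVneq k l; first by rewrite eqr_nat => /eqP.
by have := freq_gap i j 0 sep kl; rewrite E !subrr normr0 leNgt delta0.
Qed.

(** Replacing the value at 0 by 1 allows products over all frequencies,
    including l_a itself, without changing prod_(b <> a) |l_a - l_b|. *)
Definition gap (R : realFieldType) (s : R) : R := if s == 0 then 1 else `|s|.

(** For m + 1 consecutive points, the distance from t to the farther of the two
    end points is at least m / 2; removing that end point gives the
    induction.  The bound delta is used only for the last remaining point. *)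
Lemma progression_prod_ge (R : realFieldType) (g : R -> R) (delta t : R) (m : nat) :
  0 <= delta -> (forall s, `|s| <= g s) ->
  (forall j : int, delta <= g (t - j%:~R)) ->
  delta * m`!%:R / 2 ^+ m <= \prod_(j < m.+1) g (t - j%:R).
Proof.
move=> delta0 gs; elim: m t => [|m IHm] t gt.
  by rewrite big_ord1 divr1 mulr1; exact: (gt 0).
have g0 s : 0 <= g s by apply: le_trans (gs s).
have half : delta * m.+1`!%:R / 2 ^+ m.+1 =
    delta * m`!%:R / 2 ^+ m * (m.+1%:R / 2) :> R.
  by rewrite factS natrM exprS invfM; ring.
rewrite half; have [tm|tm] := leP (m.+1%:R / 2) `|t - m.+1%:R|.
  rewrite big_ord_recr /= ler_pM ?IHm//.
  - by rewrite !mulr_ge0// invr_ge0 exprn_ge0.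
  - exact: le_trans (gs _).
rewrite big_ord_recl /= mulrC ler_pM//.
- by rewrite !mulr_ge0// invr_ge0 exprn_ge0.
- rewrite subr0 (le_trans _ (gs _))//.
  have : m.+1%:R <= `|t| + `|t - m.+1%:R|.
    rewrite -[leLHS]ger0_norm// -[in leLHS](subKr t m.+1%:R).
    by rewrite (le_trans (ler_normB _ _)).
  by move: tm; lra.
- have gt1 (j : int) : delta <= g (t - 1 - j%:~R).
    by rewrite -addrA -opprD -[1](@mulr1z) -intrD.
  apply: (le_trans (IHm (t - 1) gt1)).
  rewrite le_eqVlt; apply/orP; left; apply/eqP/eq_bigr => j _.
  by rewrite /bump /= natrD opprD addrA.
Qed.

Lemma exprn_le_fact_expR (R : realType) (n m : nat) :
  n%:R ^+ m <= m`!%:R * expR n%:R :> R.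
Proof.
case: m => [|m]; first by rewrite fact0 mul1r -[leLHS]expR0 ler_expR.
rewrite mulrC -ler_pdivrMr ?ltr0n ?fact_gt0//.
by apply: le_trans (expR_ge1Dxn m (ler0n _ _)); rewrite lerDr.
Qed.

(** Taking out n^(m+1) rather than n^m, where m is the last index of the
    progression, makes these factors multiply to n^N over all progressions. *)
Lemma gap_progression_ge (R : realType) (d n : nat) (x : d.-tuple R) (delta : R)
    (k l : {ffun 'I_d -> 'I_n.+1}) (i : nat) :
  (1 <= n)%N -> 0 < delta <= 1 -> separated n x delta ->
  delta / (n%:R * (2 * expR 1) ^+ n) * n%:R ^+ (n - \sum_i l i).+1 <=
  \prod_(j < (n - \sum_i l i).+1)
     gap (freq x (fun s => k s) i - freq x (fun s => l s) j).
Proof.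
move=> n1 /andP[delta0 delta1] sep.
set m := (n - _)%N; have mn : (m <= n)%N by rewrite leq_subr.
have n0 : 0 < n%:R :> R by rewrite ltr0n.
have En : 0 < (2 * expR 1) ^+ n :> R by rewrite exprn_gt0// mulr_gt0// expR_gt0.
pose t := freq x (fun s => k s) i - \sum_s (l s)%:R * tnth x s.
have tE (j : nat) : freq x (fun s => k s) i - freq x (fun s => l s) j = t - j%:R.
  by rewrite /t /freq; ring.
under eq_bigr do rewrite tE.
have gap_ge (s : R) : `|s| <= gap s.
  by rewrite /gap; case: eqP => [->|//]; rewrite normr0.
have t_gap (j : int) : delta <= gap (t - j%:~R).
  rewrite /gap; case: eqP => // tj.
  (* Different tails are separated by delta; equal ones differ by an integer. *)
  have [kl|kl] := eqVneq k l; last first.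
    have := freq_gap i 0 j sep kl.
    by rewrite /t /freq add0r.
  move: tj; rewrite /t /freq kl addrK => tj.
  apply: (le_trans delta1); rewrite -[i%:R]/(i%:~R) -rmorphB /= -intr_norm ler1z.
  rewrite -gtz0_ge1 normr_gt0; apply: contra_notN tj => /eqP ij.
  by rewrite -[i%:R]/(i%:~R) -rmorphB /= ij.
apply: le_trans (progression_prod_ge m (ltW delta0) gap_ge t_gap).
rewrite -mulrA -[X in _ <= X]mulrA ler_pM2l//.
rewrite ler_pdivlMr ?exprn_gt0// -mulrA ler_pdivrMl ?mulr_gt0//.
rewrite exprS -!mulrA ler_pM2l//.
rewrite exprMn -expRM_natl mulr1 -mulrA mulrC [expR _ * _]mulrC.
apply: ler_pM; rewrite ?exprn_ge0 ?exprn_le_fact_expR//.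
by rewrite ler_weXn2l// ler1n.
Qed.

(** With E = 2 e, each progression contributes its power of n and a single
    factor delta / (n E^n).  There are at most (n+1)^d progressions, so for
    delta = eps n^(-mu) these factors cost only exp(O(n^(d+1))). *)
Lemma gap_product_ge (R : realType) (d n : nat) (x : d.-tuple R) (delta : R)
    (a : mpoly.bmultinom d.+1 n.+1) :
  (1 <= n)%N -> 0 < delta <= 1 -> separated n x delta ->
  (delta / (n%:R * (2 * expR 1) ^+ n)) ^+ (n.+1 ^ d) *
    n%:R ^+ #|{: mpoly.bmultinom d.+1 n.+1}| <=
  \prod_(b | b != a)
    `|freq x (fun s => mnm_tail a s) (a ord0) -
      freq x (fun s => mnm_tail b s) (b ord0)|.
Proof.
move=> n1 delta01 sep; have /andP[delta0 delta1] := delta01.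
set E : R := 2 * expR 1.
have n0 : 0 < n%:R :> R by rewrite ltr0n.
have E1 : 1 <= expR 1 :> R by rewrite -[leLHS]expR0 ler_expR.
have En : 1 <= E ^+ n by rewrite exprn_ege1// /E; lra.
have th0 : 0 < delta / (n%:R * E ^+ n).
  by rewrite divr_gt0// mulr_gt0// (lt_le_trans _ En).
pose G (l : {ffun 'I_d -> 'I_n.+1}) (j : nat) :=
  gap (freq x (fun s => mnm_tail a s) (a ord0) - freq x (fun s => l s) j).
have -> : \prod_(b | b != a) `|freq x (fun s => mnm_tail a s) (a ord0) -
      freq x (fun s => mnm_tail b s) (b ord0)| =
    \prod_(b : mpoly.bmultinom d.+1 n.+1) G (mnm_tail b) (b ord0).
  rewrite [RHS](bigD1 a)//= {1}/G subrr /gap eqxx mul1r.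
  apply: eq_bigr => b ba; rewrite /G /gap subr_eq0; case: eqP => // ab.
  have [tab hab] := freq_inj delta0 sep ab.
  case/eqP: ba; apply/val_inj/mpoly.mnmP => i.
  have [j ->|->] := unliftP ord0 i; last by [].
  have := congr1 (fun k : {ffun 'I_d -> 'I_n.+1} => val (k j)) tab.
  by rewrite /= !ffunE !inordK ?bmultinom_ltn.
rewrite -prodr_const (prod_bmultinom (fun _ _ => n%:R)) prod_bmultinom.
under eq_bigr do rewrite prodr_const card_ord.
apply: (@le_trans _ _ (\prod_(k : {ffun 'I_d -> 'I_n.+1} | (\sum_i k i <= n)%N)
    (delta / (n%:R * E ^+ n) * n%:R ^+ (n - \sum_i k i).+1))); last first.
  apply: ler_prod => k _; rewrite gap_progression_ge// andbT.
  by rewrite mulr_ge0 ?exprn_ge0// ltW.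
rewrite big_split /= ler_wpM2r//; first by apply: prodr_ge0 => k _; rewrite exprn_ge0.
(* There are at most (n+1)^d progressions, and delta / (n E^n) <= 1. *)
rewrite prodr_const ler_wiXn2l ?(ltW th0)//.
  rewrite ler_pdivrMr ?mulr_gt0// ?(lt_le_trans _ En)// mul1r.
  by rewrite (le_trans delta1)// mulr_ege1// ler1n.
by rewrite (leq_trans (max_card _))// card_ffun !card_ord.
Qed.

(** * The estimate for Diophantine vectors *)

Local Notation normc := ComplexField.Normc.normc.

Lemma normr_complexE (R : realType) (z : R[i]) : `|z| = (normc z)%:C.
Proof. by case: z => a b; rewrite normc_def. Qed.

Lemma normc_ge0 (R : realType) (z : R[i]) : 0 <= normc z.
Proof. by case: z => a b; exact: sqrtr_ge0. Qed.

Lemma meval_sum_bmultinom (R : realType) (l n : nat) (v : 'I_l -> R[i])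
    (P : mpoly.mpoly l R[i]) : poly_deg_le n P ->
  mpoly.meval v P = \sum_(b : mpoly.bmultinom l n.+1)
    mpoly.mcoeff b P * \prod_i v i ^+ b i.
Proof.
rewrite /poly_deg_le /= => /mpoly.mpolywE {1}->.
rewrite raddf_sum /=; apply: eq_bigr => b _.
by rewrite mpoly.mevalZ mpoly.mevalX.
Qed.

Lemma meval_polydisk_le (R : realType) (l n : nat) (z : l.-tuple R[i])
    (P : mpoly.mpoly l R[i]) : poly_deg_le n P -> polydisk z ->
  normc (mpoly.meval (tnth z) P) <=
  \sum_(b : mpoly.bmultinom l n.+1) normc (mpoly.mcoeff b P).
Proof.
move=> Pn z1; rewrite (meval_sum_bmultinom _ Pn) -lecR -normr_complexE rmorph_sum /=.
apply: (le_trans (ler_norm_sum _ _ _)); apply: ler_sum => b _.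
rewrite normrM -normr_complexE -[leRHS]mulr1 ler_wpM2l// normr_prod.
by apply: Num.Theory.prodr_ile1 => i _; rewrite normr_ge0 normrX exprn_ile1// z1.
Qed.

(** On real parameters the complex exponential is the real one, so the
    restriction of P is a sum of real exponentials with complex coefficients. *)
Lemma meval_exp_curve (R : realType) (d n : nat) (x : d.-tuple R)
    (P : mpoly.mpoly d.+1 R[i]) (t : R) : poly_deg_le n P ->
  mpoly.meval (tnth [tuple of cexp t%:C ::
      [tuple cexp ((tnth x j)%:C * t%:C) | j < d]]) P =
  \sum_(b : mpoly.bmultinom d.+1 n.+1) mpoly.mcoeff b P *
    (expR (freq x (fun s => mnm_tail b s) (b ord0) * t))%:C.
Proof.
move=> Pn; rewrite (meval_sum_bmultinom _ Pn); apply: eq_bigr => b _.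
have cexpR (s : R) : cexp s%:C = (expR s)%:C.
  by rewrite /cexp /= cos0 sin0 mulr1 mulr0.
have cexpM (s : R) : cexp (s%:C * t%:C) = (expR (s * t))%:C.
  by rewrite -(rmorphM (real_complex R)) cexpR.
congr (_ * _); rewrite big_ord_recl tnth0 cexpR /freq mulrDl expRD rmorphM.
congr (_ * _); first by rewrite expRM_natl rmorphXn.
rewrite mulr_suml expR_sum rmorph_prod; apply: eq_bigr => i _.
rewrite tnthS tnth_mktuple cexpM -rmorphXn -expRM_natl.
by rewrite /mnm_tail ffunE inordK ?bmultinom_ltn// mulrA.
Qed.

Lemma freq_le (R : realType) (d n : nat) (x : d.-tuple R)
    (b : mpoly.bmultinom d.+1 n.+1) : cube x ->
  `|freq x (fun s => mnm_tail b s) (b ord0)| <= n%:R.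
Proof.
move=> x1; apply: (@le_trans _ _ (mpoly.mdeg b)%:R); last first.
  by rewrite ler_nat -ltnS mpoly.bmdeg.
rewrite mpoly.mdegE big_ord_recl natrD (le_trans (ler_normD _ _))//.
rewrite normr_nat lerD2l natr_sum (le_trans (ler_norm_sum _ _ _))//.
apply: ler_sum => i _; rewrite ffunE inordK ?bmultinom_ltn//.
by rewrite normrM normr_nat ler_piMr// ler_norml; exact: x1.
Qed.

(** The two bounds combined: sampling controls c_a times the product of the
    distances, and the product is large.  M is left free so that the sharp
    count of monomials enters only in the final computation. *)
Lemma coef_bound (R : realType) (d n : nat) (x : d.-tuple R) (delta M : R)
    (P : mpoly.mpoly d.+1 R[i]) (a : mpoly.bmultinom d.+1 n.+1) :
  (1 <= n)%N -> cube x -> 0 < delta <= 1 ->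
  separated n x delta ->
  #|{: mpoly.bmultinom d.+1 n.+1}|%:R <= M -> n%:R <= M ->
  poly_deg_le n P -> (supnorm (exp_curve x) P <= 1)%E ->
  normc (mpoly.mcoeff a P) *
    ((delta / (n%:R * (2 * expR 1) ^+ n)) ^+ (n.+1 ^ d) *
      n%:R ^+ #|{: mpoly.bmultinom d.+1 n.+1}|) <=
  ((1 + expR 1) * expR 1 * M) ^+ #|{: mpoly.bmultinom d.+1 n.+1}|.
Proof.
move=> n1 x1 delta01 sep NM nM Pn P1.
have c0 := normc_ge0 (mpoly.mcoeff a P).
apply: le_trans (ler_wpM2l c0 (gap_product_ge a n1 delta01 sep)) _.
rewrite -lecR rmorphM /= -normr_complexE.
apply: (@exp_sum_coef_bound _ _ _ (fun b : mpoly.bmultinom d.+1 n.+1 =>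
  mpoly.mcoeff b P)) => // [b|t t01].
  exact: le_trans (freq_le _ x1) nM.
rewrite -meval_exp_curve// normr_complexE -[1]/(1%:C) lecR -lee_fin.
apply: le_trans P1; apply: ereal_sup_ubound => /=.
eexists; last by reflexivity.
exists t%:C => //=; rewrite normc_def /= expr0n addr0 sqrtr_sqr.
by have /andP[t0 t1] := t01; rewrite ger0_norm// -[1]/(1%:C) lecR.
Qed.

(** This collects the error terms; it is used with p = n^d, q = n^(d+1),
    D = (d+1)!, L = log n, N the number of monomials and K = (n+1)^d a bound
    for the number of progressions. *)
Lemma exponent_arith (R : realFieldType)
    (d D p q n L N K B e alpha beta gam mu : R) :
  1 <= D -> 0 <= p -> q = n * p -> 1 <= n -> 0 <= L <= n -> 0 <= B -> 0 <= e ->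
  0 <= N <= q / D + B * p -> 0 <= K <= e * p ->
  0 <= alpha -> 0 <= beta -> 0 <= gam -> 0 <= mu -> 0 <= d ->
  N * (1 + alpha + d * L) + K * (gam + (mu + 1) * L + n * beta) <=
  q * (d / D) * L + ((1 + B) * (1 + alpha) + d * B + e * (gam + mu + 1 + beta)) * q.
Proof.
move=> D1 p0 qE n1 /andP[L0 Ln] B0 e0 /andP[N0 NB] /andP[K0 Kp] a0 b0 g0 m0 d0.
have D0 : 0 < D by apply: lt_le_trans D1.
have pq : p <= q by rewrite qE ler_peMl.
have q0 : 0 <= q by apply: le_trans pq.
have qD : q / D <= q by rewrite ler_pdivrMr// ler_peMr.
have Bpq : B * p <= B * q by rewrite ler_wpM2l.
have h1 : N * (1 + alpha) <= (1 + B) * (1 + alpha) * q.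
  rewrite mulrAC ler_wpM2r//; first lra.
  by move: NB qD Bpq; lra.
have h2 : N * (d * L) <= (q / D + B * p) * (d * L).
  by rewrite ler_wpM2r// mulr_ge0.
have h3 : (B * p) * (d * L) <= d * B * q.
  have -> : B * p * (d * L) = d * B * (p * L) by ring.
  by rewrite qE [n * p]mulrC ler_wpM2l ?mulr_ge0// ler_wpM2l.
have h4 : gam + (mu + 1) * L + n * beta <= (gam + mu + 1 + beta) * n.
  have : (mu + 1) * L <= (mu + 1) * n by rewrite ler_wpM2l//; lra.
  have : gam <= gam * n by rewrite ler_peMr.
  lra.
have h5 : K * (gam + (mu + 1) * L + n * beta) <= e * (gam + mu + 1 + beta) * q.
  apply: (@le_trans _ _ (e * p * ((gam + mu + 1 + beta) * n))).
    apply: ler_pM => //; rewrite !addr_ge0// mulr_ge0//; lra.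
  by rewrite qE le_eqVlt; apply/orP; left; apply/eqP; ring.
have h6 : (q / D) * (d * L) = q * (d / D) * L by ring.
move: h1 h2 h3 h5 h6; lra.
Qed.

Lemma bernstein_exponent_le (R : realType) (d n : nat) (x : d.-tuple R) (B : R) :
  (forall (P : mpoly.mpoly d.+1 R[i]), poly_deg_le n P ->
     (supnorm (exp_curve x) P <= 1)%E ->
     \sum_(b : mpoly.bmultinom d.+1 n.+1) normc (mpoly.mcoeff b P) <= expR B) ->
  (bernstein_exponent x n <= B%:E)%E.
Proof.
move=> H; rewrite /bernstein_exponent -(@expeRK _ B%:E).
have cle : (bernstein_const x n <= (expR B)%:E)%E.
  apply: ge_ereal_sup => _ /= [P [Pn P1] <-].
  apply: ge_ereal_sup => _ /= [z z1 <-]; rewrite lee_fin.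
  exact: le_trans (meval_polydisk_le Pn z1) (H P Pn P1).
have [c0|c0] := leP 0%E (bernstein_const x n).
  by rewrite lee_lne ?in_itv/= ?c0 ?leey// lee_fin expR_ge0.
rewrite expeRK; move: c0; case: (bernstein_const x n) => [r|//|_]; last exact: leNye.
by rewrite lte_fin /= => /ltW ->; exact: leNye.
Qed.

Lemma diophantine_bernstein_exponent (R : realType) (d : nat) (x : d.-tuple R) :
  (1 <= d)%N -> cube x -> diophantine x ->
  exists C : R, 0 < C /\ forall n : nat, (1 <= n)%N ->
    (bernstein_exponent x n <=
      (n%:R ^+ d.+1 / ((d.-1)`!%:R * d.+1%:R) * ln n%:R
          + C * n%:R ^+ d.+1)%:E)%E.
Proof.
move=> d1 x1 /diophantine_separated[mu [eps [mu0 eps01 sep_x]]].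
have [B B0 binB] := bin_asymp R d.+1.
have /andP[eps0 eps1] := eps01.
pose A : R := (1 + expR 1) * expR 1 * (1 + B).
have E1 : 1 <= expR 1 :> R by rewrite -[leLHS]expR0 ler_expR.
have A1 : 1 <= A by rewrite !mulr_ege1// ?lerDl// lerDr// expR_ge0.
pose beta : R := ln (2 * expR 1).
have beta0 : 0 <= beta by rewrite ln_ge0//; lra.
pose C : R := (1 + B) * (1 + ln A) + d%:R * B + 2 ^+ d * (- ln eps + mu + 1 + beta).
have lneps0 : 0 <= - ln eps by rewrite oppr_ge0 ln_le0.
exists C; split.
  have ? : 0 <= ln A by rewrite ln_ge0.
  rewrite /C -addrA ltr_pwDl// ?addr_ge0 ?mulr_ge0 ?exprn_ge0 ?addr_ge0//.
  by rewrite mulr_gt0// ltr_pwDl.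
move=> n n1; apply: bernstein_exponent_le => P Pn P1.
set N := #|{: mpoly.bmultinom d.+1 n.+1}|.
have n1R : 1 <= n%:R :> R by rewrite ler1n.
have n0R : 0 < n%:R :> R by rewrite ltr0n.
have NB : N%:R <= n%:R ^+ d.+1 / d.+1`!%:R + B * n%:R ^+ d :> R.
  rewrite -(@ler_pM2l _ n%:R)// mulrDr mulrA -exprS mulrCA -exprS.
  apply: le_trans (binB n n1); rewrite ler_pM2l// ler_nat.
  exact: card_bmultinom_le.
(* M is both an upper bound for N and, up to a constant, a power of n. *)
pose M : R := (1 + B) * n%:R ^+ d.+1.
have nX : n%:R ^+ d <= n%:R ^+ d.+1 :> R by rewrite ler_weXn2l.
have nX1 : n%:R <= n%:R ^+ d.+1 :> R by rewrite -[leLHS]expr1 ler_weXn2l.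
have fact1 : 1 <= d.+1`!%:R :> R by rewrite ler1n fact_gt0.
have NM : N%:R <= M.
  apply: (le_trans NB); rewrite /M mulrDl mul1r lerD ?ler_wpM2l//.
  by rewrite ler_pdivrMr ?ler_peMr ?exprn_ge0// (lt_le_trans _ fact1).
have nM : n%:R <= M.
  by rewrite /M (le_trans nX1)// ler_peMl ?exprn_ge0// lerDl.
pose delta : R := eps * n%:R `^ (- mu).
have L0 : 0 <= ln n%:R :> R by rewrite ln_ge0.
have deltaE : delta = expR (ln eps - mu * ln n%:R).
  rewrite expRD lnK ?posrE// /delta /powR gt_eqF//.
  by rewrite mulNr.
have delta01 : 0 < delta <= 1.
  rewrite deltaE expR_gt0 -[leRHS]expR0 ler_expR.
  have : 0 <= mu * ln n%:R by rewrite mulr_ge0.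
  by move: lneps0; lra.
have sep : separated n x delta by exact: sep_x.
pose L : R := ln n%:R.
pose K : R := (n.+1 ^ d)%:R.
have nE : n%:R = expR L by rewrite lnK.
have AE : A = expR (ln A) by rewrite lnK// posrE (lt_le_trans _ A1).
have bE : 2 * expR 1 = expR beta :> R by rewrite lnK// posrE mulr_gt0// expR_gt0.
have thE : delta / (n%:R * (2 * expR 1) ^+ n) =
    expR (ln eps - mu * L - L - n%:R * beta).
  rewrite deltaE bE [in X in _ / X]nE -expRM_natl -expRD -expRB -/L.
  by congr expR; ring.
(* N (d+1) L comes from M^N, and - N L from the product of the distances. *)
have coefE (b : mpoly.bmultinom d.+1 n.+1) : normc (mpoly.mcoeff b P) <=
    expR (N%:R * (ln A + d%:R * L) + K * (- ln eps + (mu + 1) * L + n%:R * beta)).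
  have := coef_bound b n1 x1 delta01 sep NM nM Pn P1.
  have nNE : n%:R ^+ N = expR (N%:R * L) by rewrite expRM_natl -nE.
  rewrite -/N thE nNE -expRM_natl -/K -expRD.
  have -> : (1 + expR 1) * expR 1 * M = expR (ln A + d.+1%:R * L).
    by rewrite /M mulrA -/A expRD -AE expRM_natl -nE.
  rewrite -expRM_natl -ler_pdivlMr ?expR_gt0// -expRB; move=> /le_trans; apply.
  by rewrite ler_expR le_eqVlt; apply/orP; left; apply/eqP; rewrite -natr1; ring.
apply: (@le_trans _ _ (\sum_(b : mpoly.bmultinom d.+1 n.+1)
   expR (N%:R * (ln A + d%:R * L) + K * (- ln eps + (mu + 1) * L + n%:R * beta)))).
  by apply: ler_sum => b _.
rewrite sumr_const -/N -[_ *+ N]mulr_natl.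
(* The number of terms is absorbed in the error term. *)
have NE : N%:R <= expR N%:R :> R.
  by apply: le_trans (expR_ge1Dx _); rewrite lerDr.
apply: (le_trans (ler_wpM2r (expR_ge0 _) NE)); rewrite -expRD ler_expR.
have -> : n%:R ^+ d.+1 / ((d.-1)`!%:R * d.+1%:R) =
    n%:R ^+ d.+1 * (d%:R / d.+1`!%:R) :> R.
  congr (_ * _); case: (d) d1 => // d' _.
  rewrite /= !factS !natrM; field.
  have d0 : 0 <= d'%:R :> R by [].
  by apply/and3P; split; rewrite gt_eqF ?ltr0n ?fact_gt0//; lra.
have KB : 0 <= K <= 2 ^+ d * n%:R ^+ d.
  rewrite ler0n /= /K natrX -exprMn lerXn2r ?nnegrE ?mulr_ge0//.
  by rewrite -natr1; move: n1R; lra.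
have Ln : 0 <= L <= n%:R.
  by rewrite L0 /= ltW// ln_sublinear.
have NB' : 0 <= (N%:R : R) <= n%:R ^+ d.+1 / d.+1`!%:R + B * n%:R ^+ d.
  by rewrite NB ler0n.
have := exponent_arith fact1 (exprn_ge0 d (ltW n0R)) (exprS _ d) n1R Ln B0
  (exprn_ge0 d (ler0n _ 2)) NB' KB (ln_ge0 A1) beta0 lneps0 mu0 (ler0n _ d).
rewrite -/L /C; apply: le_trans.
by rewrite le_eqVlt; apply/orP; left; apply/eqP; ring.
Qed.

(** * Almost every vector is Diophantine *)

(** Monotonicity for nonnegative integrands that need not be measurable: every
    simple function below f is below g. *)
Lemma le_integralT_ge0 (d : measure_display) (T : measurableType d) (R : realType)
    (mu : {measure set T -> \bar R}) (f g : T -> \bar R) :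
  (forall t, 0 <= f t)%E -> (forall t, f t <= g t)%E ->
  (\int[mu]_t f t <= \int[mu]_t g t)%E.
Proof.
move=> f0 fg; have g0 t : (0 <= g t)%E by apply: le_trans (fg t).
rewrite !ge0_integralTE//; apply: le_ereal_sup => _ [h hf <-].
by exists h => // t; exact: le_trans (hf t) (fg t).
Qed.

Definition slab (R : realType) (d : nat) (q : 'rV[int]_d) (c e : R) :
    set (d.-tuple (measurableTypeR R)) :=
  [set x | cube (x : d.-tuple R) /\ `|dot_int q (x : d.-tuple R) + c| <= e].

Lemma measurable_cube (R : realType) (d : nat) :
  measurable (@cube R d : set (d.-tuple (measurableTypeR R))).
Proof.
rewrite (_ : @cube R d = \bigcap_(i in [set: 'I_d])
    (fun x : d.-tuple (measurableTypeR R) => tnth x i) @^-1` `[-1, 1]%classic).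
  apply: fin_bigcap_measurable => // i _.
  rewrite -[X in measurable X]setTI.
  have mt := @measurable_tnth _ (measurableTypeR R) d i.
  by apply: (mt measurableT); exact: measurable_itv.
by apply/seteqP; split=> x /= H i => [_|]; have := H i;
  rewrite /= in_itv /= => // /(_ I).
Qed.

Lemma measurable_slab (R : realType) (d : nat) (q : 'rV[int]_d) (c e : R) :
  measurable (slab q c e).
Proof.
pose f (x : d.-tuple (measurableTypeR R)) : R := dot_int q (x : d.-tuple R) + c.
rewrite (_ : slab q c e = @cube R d `&` (f @^-1` `[- e, e]%classic)).
  apply: measurableI; first exact: measurable_cube.
  have mf : measurable_fun setT f.
    apply: measurable_funD; last exact: measurable_cst.
    apply: measurable_sum => i; apply: measurable_funM; first exact: measurable_cst.
    exact: measurable_tnth.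
  by rewrite -[X in measurable X]setTI; exact: (mf measurableT _ (measurable_itv _)).
by apply/seteqP; split=> x; rewrite /slab /f /= in_itv /= ler_norml.
Qed.

Lemma lebesgue_measure_itvN11 (R : realType) :
  lebesgue_measure (`[-1, 1]%classic : set (measurableTypeR R)) = 2%:E.
Proof.
rewrite lebesgue_measure_itv /= lte_fin -EFinB opprK.
by have -> : (-1 < 1 :> R) by lra.
Qed.

Lemma lebesgue_tuple_cube (R : realType) (d : nat) :
  lebesgue_tuple (@cube R d : set (d.-tuple (measurableTypeR R))) = (2 ^+ d)%:E.
Proof.
pose J (i : 'I_d) : set (measurableTypeR R) := `[-1, 1]%classic.
rewrite (_ : @cube R d = [set x : d.-tuple (measurableTypeR R) | forall i,
    J i (tnth x i)]).
  rewrite lebesgue_tuple_box => [|i]; last exact: measurable_itv.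
  under eq_bigr do rewrite lebesgue_measure_itvN11.
  by rewrite prodEFin prodr_const card_ord.
by apply/seteqP; split=> x /= H i; have := H i; rewrite /J /= in_itv.
Qed.

Lemma lebesgue_tupleS (R : realType) (d : nat)
    (A : set (d.+1.-tuple (measurableTypeR R))) :
  lebesgue_tuple A = (\int[@lebesgue_measure R]_t
    lebesgue_tuple [set v : d.-tuple (measurableTypeR R) | A [tuple of t :: v]])%E.
Proof. by []. Qed.

Lemma lebesgue_slab1 (R : realType) (a c e : R) : 1 <= `|a| -> 0 <= e ->
  (lebesgue_measure [set t : measurableTypeR R | (`|a * t + c| <= e)%R] <= (2 * e)%:E)%E.
Proof.
move=> a1 e0; have a0 : 0 < `|a| by apply: lt_le_trans a1.
have aN0 : a != 0 by rewrite -normr_gt0.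
rewrite (_ : [set t | _] = `[- c / a - e / `|a|, - c / a + e / `|a|]%classic).
  rewrite lebesgue_measure_itv /=; case: ifP => _; last by rewrite lee_fin mulr_ge0.
  rewrite -EFinB lee_fin.
  have : e / `|a| <= e by rewrite ler_pdivrMr// ler_peMr.
  lra.
apply/seteqP; split=> t /=; rewrite in_itv /= -ler_distl mulNr opprK => H.
  by rewrite ler_pdivlMr// -normrM mulrDl mulfVK// [t * a]mulrC.
by move: H; rewrite ler_pdivlMr// -normrM mulrDl mulfVK// [t * a]mulrC.
Qed.

(** Since q is integral and nonzero, one coordinate has |q_i| >= 1 and bounds
    the slab in that direction.  Slicing along the first coordinate, either the
    remaining part q' of q is nonzero and every slice is a slab, or q' = 0 and
    the slab is the product of an interval set and a cube. *)
Lemma lebesgue_tuple_slab_le (R : realType) (d : nat) (q : 'rV[int]_d) (c e : R) :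
  q != 0 -> 0 <= e -> (lebesgue_tuple (slab q c e) <= (2 ^+ d * e)%:E)%E.
Proof.
move=> + e0; elim: d q c => [|d IHd] q c q0.
  by case/eqP: q0; apply/rowP => -[].
rewrite lebesgue_tupleS; pose q' : 'rV[int]_d := \row_i q 0 (lift ord0 i).
have secE (t : R) : [set v : d.-tuple (measurableTypeR R) |
      slab q c e [tuple of t :: v]] `<=`
    [set v | `|t| <= 1 /\ slab q' ((q 0 ord0)%:~R * t + c) e v].
  move=> v [] cv; rewrite /dot_int big_ord_recl tnth0 => H; split.
    by have := cv ord0; rewrite tnth0 ler_norml.
  split; first by move=> i; have := cv (lift ord0 i); rewrite tnthS.
  move: H; rewrite -addrA addrCA /dot_int.
  by under eq_bigr do rewrite tnthS; under [in X in _ -> X]eq_bigr do rewrite mxE.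
have msec (t : R) : measurable [set v : d.-tuple (measurableTypeR R) |
      slab q c e [tuple of t :: v]].
  have mcons : measurable_fun setT (fun v : d.-tuple (measurableTypeR R) =>
      [tuple of (t : measurableTypeR R) :: v]).
    by apply: measurable_cons; [exact: measurable_cst|exact: measurable_id].
  rewrite -[X in measurable X]setTI.
  by apply: (mcons measurableT); exact: measurable_slab.
have [q'0|q'0] := eqVneq q' 0; last first.
  have r0 : 0 <= 2 ^+ d * e :> R by rewrite mulr_ge0.
  apply: (@le_trans _ _ (\int[@lebesgue_measure R]_t
     ((2 ^+ d * e)%:E * (\1_(`[-1, 1]%classic : set R) t)%:E))%E).
    apply: le_integralT_ge0 => t; first exact: measure_ge0.
    have [t1|t1] := boolP (`|t| <= 1).
      rewrite indicE mem_set ?mule1; last by rewrite /= in_itv /= -ler_norml.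
      apply: le_trans (IHd q' ((q 0 ord0)%:~R * t + c) q'0).
      apply: le_measure; rewrite ?inE //; first exact: measurable_slab.
      by move=> v /secE[].
    rewrite [X in lebesgue_tuple X](_ : _ = set0) ?measure0 ?mule_ge0 ?lee_fin//.
    by apply/seteqP; split=> // v /secE[]; rewrite (negbTE t1).
  rewrite ge0_integralZl_EFin//; last first.
    by apply/measurable_EFinP; exact: measurable_indic.
  rewrite integral_indic// setIT [X in (_ * X <= _)%E](lebesgue_measure_itvN11 R).
  by rewrite -EFinM lee_fin mulrAC -exprSr.
have q00 : 1 <= `|(q 0 ord0)%:~R| :> R.
  rewrite -intr_norm ler1z -gtz0_ge1 normr_gt0; apply: contra q0 => /eqP q00.
  apply/eqP/rowP => i; rewrite [RHS]mxE.
  have [j ->|->//] := unliftP ord0 i.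
  by have /rowP/(_ j) := q'0; rewrite !mxE.
pose S : set R := [set t | `|(q 0 ord0)%:~R * t + c| <= e].
have mS : measurable S.
  have mf : measurable_fun setT (fun t : measurableTypeR R => (q 0 ord0)%:~R * t + c).
    apply: measurable_funD; last exact: measurable_cst.
    by apply: measurable_funM; [exact: measurable_cst|exact: measurable_id].
  rewrite (_ : S = setT `&` (fun t => (q 0 ord0)%:~R * t + c) @^-1` `[- e, e]%classic).
    exact: (mf measurableT _ (measurable_itv _)).
  by apply/seteqP; split=> t; rewrite /S /= in_itv /= -ler_norml => // -[].
apply: (@le_trans _ _ (\int[@lebesgue_measure R]_t ((2 ^+ d)%:E * (\1_S t)%:E))%E).
  apply: le_integralT_ge0 => t; first exact: measure_ge0.
  have [St|St] := boolP (t \in S).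
    rewrite indicE St mule1 -lebesgue_tuple_cube.
    apply: le_measure; rewrite ?inE //; first exact: measurable_cube.
    by move=> v /secE[_ []].
  rewrite [X in lebesgue_tuple X](_ : _ = set0) ?measure0 ?mule_ge0 ?lee_fin//.
  apply/seteqP; split=> // v /secE[_ [_]]; rewrite q'0 /dot_int.
  by under eq_bigr do rewrite mxE mul0r; rewrite big1// add0r => H;
    case/negP: St; exact/mem_set.
rewrite ge0_integralZl_EFin//; last first.
  by apply/measurable_EFinP; exact: measurable_indic.
rewrite integral_indic// setIT exprSr -mulrA EFinM lee_wpmul2l ?lee_fin//.
exact: lebesgue_slab1.
Qed.

Lemma nneseries_inv_sqr_le (R : realType) :
  (\sum_(n <oo) ((n.+1%:R ^+ 2)^-1 : R)%:E <= 2%:E)%E.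
Proof.
apply: lime_le.
  by apply: is_cvg_nneseries => n _ _; rewrite lee_fin invr_ge0 exprn_ge0.
apply: nearW => N; rewrite sumEFin lee_fin big_mkord.
have H : \sum_(i < N.+1) (i.+1%:R ^+ 2)^-1 <= 2 - N.+1%:R^-1 :> R.
  elim: N => [|N IHN]; first by rewrite big_ord1 expr1n invr1; lra.
  rewrite big_ord_recr /=; apply: (le_trans (lerD IHN (lexx _))).
  have N0 : 0 <= N%:R :> R by [].
  rewrite -addrA lerD2l -[N.+2%:R]natr1 -[N.+1%:R]natr1; set a := N%:R + 1.
  have a1 : 1 <= a by rewrite /a; lra.
  rewrite -subr_ge0.
  have -> : - (a + 1)^-1 - (- a^-1 + ((a + 1) ^+ 2)^-1) = (a * (a + 1) ^+ 2)^-1.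
    by field; rewrite !gt_eqF//; lra.
  by rewrite invr_ge0 mulr_ge0 ?exprn_ge0//; lra.
apply: le_trans (_ : \sum_(i < N.+1) (i.+1%:R ^+ 2)^-1 <= 2).
  by rewrite [leRHS]big_ord_recr /= lerDl invr_ge0 exprn_ge0.
by apply: (le_trans H); rewrite gerBl invr_ge0.
Qed.

Lemma measure_bigsetU_le (d : measure_display) (T : measurableType d) (R : realType)
    (mu : {measure set T -> \bar R}) (I : Type) (r : seq I) (P : pred I)
    (F : I -> set T) : (forall i, measurable (F i)) ->
  (mu (\big[setU/set0]_(i <- r | P i) F i) <= \sum_(i <- r | P i) mu (F i))%E.
Proof.
move=> mF; elim: r => [|i r IHr]; first by rewrite !big_nil measure0.
rewrite !big_cons; case: ifP => // _.
apply: le_trans (measureU2 _ (mF i) _) _.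
  by apply: bigsetU_measurable => j _.
exact: leeD2l.
Qed.

Lemma max_norm_nat (R : realType) (d : nat) (q : 'rV[int]_d) :
  exists m : nat, max_norm R q = m%:R.
Proof.
rewrite /max_norm; elim/big_ind : _ => [|_ _ [m ->] [m' ->]|i _].
- by exists 0%N.
- by exists (maxn m m'); rewrite natr_max.
- by exists `|q ord0 i|%N; rewrite -intr_norm -abszE.
Qed.

Lemma le_max_norm (R : realType) (d : nat) (q : 'rV[int]_d) (i : 'I_d) :
  `|(q 0 i)%:~R| <= max_norm R q.
Proof. exact: (le_bigmax _ (fun i => `|(q 0 i)%:~R|) i). Qed.

Lemma dot_int_le (R : realType) (d : nat) (q : 'rV[int]_d) (x : d.-tuple R) :
  cube x -> `|dot_int q x| <= d%:R * max_norm R q.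
Proof.
move=> x1; rewrite /dot_int (le_trans (ler_norm_sum _ _ _))//.
apply: (@le_trans _ _ (\sum_(i < d) max_norm R q)); last first.
  by rewrite sumr_const card_ord mulr_natl.
apply: ler_sum => i _.
by rewrite normrM (le_trans _ (le_max_norm _ q i))// ler_piMr// ler_norml.
Qed.

Definition centered (W : nat) (i : 'I_(2 * W).+1) : int := i%:Z - W%:Z.

Lemma centeredP (W : nat) (z : int) : `|z| <= W%:Z ->
  exists i, @centered W i = z.
Proof.
move=> zW; exists (inord (absz (z + W%:Z))); rewrite /centered inordK; lia.
Qed.

(** The union of the slabs of the pairs (q, p) needed for the vectors q of
    max-norm n + 1: on the cube |q.x| <= d (n + 1), so |p| <= (d + 2) (n + 1)
    for every relevant p.  Admitting all q with entries up to the same bound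
    does not change the order of the number of pairs. *)
Definition near_resonance (R : realType) (d : nat) (eps : R) (n : nat) :
    set (d.-tuple (measurableTypeR R)) :=
  let W := ((d + 2) * n.+1)%N in
  \big[setU/set0]_(r : {ffun 'I_d -> 'I_(2 * W).+1} * 'I_(2 * W).+1 |
      \row_i centered (r.1 i) != 0)
    slab (\row_i centered (r.1 i)) (- (centered r.2)%:~R)
      (2 * eps / n.+1%:R ^+ (d + 3)).

Lemma measurable_near_resonance (R : realType) (d : nat) (eps : R) (n : nat) :
  measurable (@near_resonance R d eps n).
Proof. by apply: bigsetU_measurable => r _; exact: measurable_slab. Qed.

(** There are (2 W + 1)^(d+1) slabs, W = (d + 2) (n + 1), each of measure at
    most 2^(d+1) eps (n + 1)^(-(d+3)). *)
Lemma near_resonance_le (R : realType) (d : nat) (eps : R) (n : nat) : 0 <= eps ->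
  (lebesgue_tuple (@near_resonance R d eps n) <=
   (2 ^+ d.+1 * (3 * (d + 2))%:R ^+ d.+1 * eps)%:E * ((n.+1%:R ^+ 2)^-1)%:E)%E.
Proof.
move=> eps0; set W := ((d + 2) * n.+1)%N.
apply: le_trans (measure_bigsetU_le _ _ _ _) _ => [r|]; first exact: measurable_slab.
set b : R := 2 ^+ d * (2 * eps / n.+1%:R ^+ (d + 3)).
have b0 : 0 <= b by rewrite !mulr_ge0 ?exprn_ge0// invr_ge0 exprn_ge0.
apply: (@le_trans _ _ (\sum_(r : {ffun 'I_d -> 'I_(2 * W).+1} * 'I_(2 * W).+1) b%:E)%E).
  rewrite big_mkcond /=; apply: lee_sum => r _; case: ifPn => [r0|_].
    by apply: lebesgue_tuple_slab_le => //; rewrite !mulr_ge0// invr_ge0 exprn_ge0.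
  by rewrite lee_fin.
rewrite sumEFin -EFinM lee_fin sumr_const card_prod card_ffun !card_ord -expnSr.
rewrite -[b *+ _]mulr_natl natrX.
have W3 : (2 * W).+1%:R <= (3 * (d + 2))%:R * n.+1%:R :> R.
  by rewrite -natrM ler_nat /W; lia.
apply: le_trans (ler_wpM2r b0 (lerXn2r d.+1 _ _ W3)) _; rewrite ?nnegrE ?mulr_ge0//.
rewrite exprMn /b le_eqVlt; apply/orP; left; apply/eqP.
rewrite (_ : (d + 3 = d.+1 + 2)%N) ?exprD; last by lia.
rewrite [2 ^+ d.+1]exprS; field.
by rewrite nat1r expf_neq0 pnatr_eq0.
Qed.

(** Outside these unions, x satisfies the Diophantine inequality with exponent
    d + 3 and constant eps: a vector q of max-norm n + 1 violating it would put
    x in a slab of the union of index n. *)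
Lemma diophantine_of_near_resonance (R : realType) (d : nat) (eps : R)
    (x : d.-tuple R) :
  0 < eps <= 1 -> cube x -> (forall n, ~ near_resonance eps n x) ->
  diophantine x.
Proof.
move=> /andP[eps0 eps1] x1 xN; exists (d + 3)%:R, eps; split => //.
  by rewrite ler_nat leq_addr.
move=> q q0; rewrite ltNge; apply/negP => dx.
have [[|n] mE] := max_norm_nat R q.
  by have := max_norm_ge1 R q0; rewrite mE ler10.
apply: (xN n); rewrite /near_resonance; set W := ((d + 2) * n.+1)%N.
pose eta := eps / n.+1%:R ^+ (d + 3).
have n1 : 1 <= n.+1%:R :> R by rewrite ler1n.
have eta0 : 0 < eta by rewrite divr_gt0// exprn_gt0.
have eta1 : eta <= 1.
  by rewrite ler_pdivrMr ?exprn_gt0// mul1r (le_trans eps1)// exprn_ege1.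
have etaE : eps * max_norm R q `^ (- (d + 3)%:R) = eta.
  by rewrite mE powRN powR_mulrn.
(* The infimum defining dist_int need not be attained a priori, so the slabs
   have twice the width that dx gives. *)
have : dist_int (dot_int q x) < 2 * eta.
  by rewrite (le_lt_trans dx)// etaE ltr_pMl// ltr1n.
case/inf_lt => [|_ [p _ <-] px]; first by exists `|dot_int q x - 0%:~R|; exists 0.
have qW i : `|q 0 i| <= W%:Z.
  rewrite -(ler_int R) intr_norm (le_trans (le_max_norm _ q i))// mE.
  by rewrite -[n.+1%:R]/(n.+1%:~R) ler_int /W; nia.
have pW : `|p| <= W%:Z.
  rewrite -(ler_int R) intr_norm -[p%:~R](subKr (dot_int q x)).
  rewrite (le_trans (ler_normB _ _))//.
  apply: (le_trans (lerD (dot_int_le q x1) (ltW px))).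
  by rewrite mE -[W%:~R]/(W%:R) /W natrM natrD; lra.
have [p' p'E] := centeredP pW.
have /choice[q' q'E] : forall i, exists j, @centered W j = q 0 i.
  by move=> i; exact: centeredP.
have qE : \row_i centered ([ffun i => q' i] i) = q.
  by apply/rowP => i; rewrite !mxE ffunE q'E.
rewrite (bigD1 ([ffun i => q' i], p')) /=; last by rewrite qE.
left; rewrite qE; split=> //.
by rewrite p'E; apply: ltW; move: px; rewrite /eta mulrA.
Qed.

Lemma ae_diophantine (R : realType) (d : nat) :
  {ae @lebesgue_tuple R d, forall x : d.-tuple R, cube x -> diophantine x}.
Proof.
pose c : R := 2 ^+ d.+1 * (3 * (d + 2))%:R ^+ d.+1.
have c0 : 0 <= c by rewrite mulr_ge0 ?exprn_ge0.
pose U k := \bigcup_n @near_resonance R d k.+1%:R^-1 n.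
have mU k : measurable (U k).
  by apply: bigcupT_measurable => n; exact: measurable_near_resonance.
have U_le k : (lebesgue_tuple (U k) <= (2 * c / k.+1%:R)%:E)%E.
  apply: (@le_trans _ _ (\sum_(n <oo)
      lebesgue_tuple (@near_resonance R d k.+1%:R^-1 n))%E).
    apply: measure_sigma_subadditive (mU k) (@subset_refl _ _) => n.
    exact: measurable_near_resonance.
  apply: (@le_trans _ _ (\sum_(n <oo) ((c * k.+1%:R^-1)%:E * ((n.+1%:R ^+ 2)^-1)%:E))%E).
    apply: lee_nneseries => // n _; apply: near_resonance_le.
    by rewrite invr_ge0.
  rewrite nneseriesZl; last by move=> n _; rewrite lee_fin invr_ge0 exprn_ge0.
  have -> : (2 * c / k.+1%:R)%:E = ((c / k.+1%:R)%:E * 2%:E)%E.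
    by rewrite -EFinM -mulrA mulrC.
  apply: lee_wpmul2l; last exact: nneseries_inv_sqr_le.
  by rewrite lee_fin divr_ge0.
exists (\bigcap_k U k); split.
- exact: bigcapT_measurable.
- apply/eqP; rewrite eq_le measure_ge0 andbT; apply/lee_addgt0Pr => e e0.
  rewrite add0e.
  pose k := Num.truncn (2 * c / e).
  apply: (@le_trans _ _ (lebesgue_tuple (U k))).
    apply: le_measure; rewrite ?inE//; first exact: bigcapT_measurable.
    exact: bigcap_inf.
  apply: (le_trans (U_le k)); rewrite lee_fin ler_pdivrMr// [e * _]mulrC -ler_pdivrMr//.
  exact/ltW/truncnS_gt.
- move=> x /= xD k _; apply: contrapT => xU; apply: xD => x1.
  apply: (@diophantine_of_near_resonance R d k.+1%:R^-1) => //.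
    by rewrite invr_gt0 ltr0n invf_le1 ?ler1n.
  by move=> n xn; apply: xU; exists n.
Qed.

Theorem theorem1p2 (R : realType) (d : nat) (d_ge1 : (1 <= d)%N) :
  (forall x : d.-tuple R, cube x -> diophantine x ->
    exists C : R, 0 < C /\ forall n : nat, (1 <= n)%N ->
      (bernstein_exponent x n <=
        (n%:R ^+ d.+1 / ((d.-1)`!%:R * d.+1%:R) * ln n%:R
          + C * n%:R ^+ d.+1)%:E)%E)
  /\
  {ae @lebesgue_tuple R d, forall x : d.-tuple R, cube x ->
    exists C : R, 0 < C /\ forall n : nat, (1 <= n)%N ->
      (bernstein_exponent x n <=
        (n%:R ^+ d.+1 / ((d.-1)`!%:R * d.+1%:R) * ln n%:R
          + C * n%:R ^+ d.+1)%:E)%E}.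
Proof.
have main (x : d.-tuple R) := @diophantine_bernstein_exponent R d x d_ge1.
split=> //; apply: negligibleS (@ae_diophantine R d) => x /= xC dx.
by apply: xC => x1; exact: main (dx x1).
Qed.
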